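(* Let $\Gamma$ be a commutative group, let $T$ be a commutative refinement $\Gamma$-monoid, and let $Q$, $L$ and $N$ be $\Gamma$-order-ideals of $T$ such that $L\subseteq Q$. Then there is an isomorphism of monoids $$Q/\bigl(L+(Q\cap N)\bigr)\;\cong\;(Q+N)/(L+N).$$
   Context: Monoids are commutative, written additively, with identity $0$. A $\Gamma$-monoid is a monoid $T$ with an action $(\alpha,a)\mapsto {}^{\alpha}a$ of the group $\Gamma$ on $T$ such that ${}^{\alpha}(a+b)={}^{\alpha}a+{}^{\alpha}b$. $T$ is refinement if whenever $a+b=c+d$ in $T$ there are $e_1,e_2,e_3,e_4\in T$ with $a=e_1+e_2$, $b=e_3+e_4$, $c=e_1+e_3$, $d=e_2+e_4$. Write $a\le b$ if $b=a+c$ for some $c\in T$. A $\Gamma$-order-ideal of $T$ is a submonoid $I$ of $T$ that is closed under the action of $\Gamma$ and hereditary ($a\le b$ and $b\in I$ imply $a\in I$). For submonoids $A,B$ of $T$, $A+B=\{a+b:a\in A,\ b\in B\}$. For a submonoid $H$ of a monoid $M$, $x\,\rho_H\,y$ means $(x+H)\cap(y+H)\ne\varnothing$; this is an equivalence relation, $\rho_H(x)$ is the class of $x$, and $M/H=\{\rho_H(x):x\in M\}$ is a monoid under $\rho_H(x)+\rho_H(y)=\rho_H(x+y)$. *)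

(* Defs.v *)
From HB Require Import structures.
From mathcomp Require Import all_boot all_order all_algebra.
From mathcomp Require Import boolp classical_sets.

Set Implicit Arguments.
Unset Strict Implicit.
Unset Printing Implicit Defensive.

Import GRing.Theory.
Local Open Scope ring_scope.
Local Open Scope quotient_scope.
Local Open Scope classical_set_scope.

(* A commutative group is a [zmodType], so that the group law of G is written
   additively. Each [act g] is bijective, so [act g 0 = 0] is a consequence. *)
Record gamma_action (G : zmodType) (T : nmodType) := GammaAction {
  act :> G -> T -> T;
  act0 : forall x, act 0 x = x;
  actD : forall g h x, act (g + h) x = act g (act h x);
  act_add : forall g x y, act g (x + y) = act g x + act g y }.

Definition refinement (T : nmodType) : Prop :=
  forall a b c d : T, a + b = c + d ->
  exists e1 e2 e3 e4 : T,
    [/\ a = e1 + e2, b = e3 + e4, c = e1 + e3 & d = e2 + e4].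

Definition mle (T : nmodType) (a b : T) : Prop := exists c, b = a + c.

Definition gamma_order_ideal (G : zmodType) (T : nmodType)
    (act : gamma_action G T) (I : addrClosed T) : Prop :=
  (forall g x, x \in I -> act g x \in I) /\
  (forall a b, mle a b -> b \in I -> a \in I).

Section Sum.
Variables (T : nmodType) (A B : addrClosed T).

Definition msum_pred : {pred T} :=
  fun x => `[< exists a b, [/\ a \in A, b \in B & x = a + b] >].

Lemma msum_subproof : addr_closed msum_pred.
Proof.
split=> [|x y].
  by apply/asboolP; exists 0, 0; rewrite !rpred0 addr0.
move=> /asboolP[a [b [aA bB ->]]] /asboolP[c [d [cA dB ->]]].
by apply/asboolP; exists (a + c), (b + d); rewrite !rpredD // addrACA.
Qed.

HB.instance Definition _ := GRing.isAddClosed.Build T msum_pred msum_subproof.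

Definition msum : addrClosed T := msum_pred.
End Sum.

Section Inter.
Variables (T : nmodType) (A B : addrClosed T).

Definition mcap_pred : {pred T} := fun x => (x \in A) && (x \in B).

Lemma mcap_subproof : addr_closed mcap_pred.
Proof.
split=> [|x y]; first by apply/andP; rewrite !rpred0.
by move=> /andP[xA xB] /andP[yA yB]; apply/andP; rewrite !rpredD.
Qed.

HB.instance Definition _ := GRing.isAddClosed.Build T mcap_pred mcap_subproof.

Definition mcap : addrClosed T := mcap_pred.
End Inter.

Section Submonoid.
Variables (T : nmodType) (M : addrClosed T).

Definition submonoid := {x : T | x \in M}.
HB.instance Definition _ := SubChoice.on submonoid.

Lemma submonoid_subproof : addr_closed (fun x => x \in M).
Proof. exact: rpred0D. Qed.

HB.instance Definition _ := GRing.SubChoice_isSubNmodule.Build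
  T (fun x => x \in M) submonoid submonoid_subproof.

Variable H : addrClosed T.

Definition within_pred : {pred submonoid} := fun x => val x \in H.

Lemma within_subproof : addr_closed within_pred.
Proof.
split=> [|x y]; first exact: rpred0.
by rewrite !unfold_in /within_pred; apply: rpredD.
Qed.

HB.instance Definition _ :=
  GRing.isAddClosed.Build submonoid within_pred within_subproof.

Definition within : addrClosed submonoid := within_pred.
End Submonoid.

Section Quotient.
Variables (M : nmodType) (H : addrClosed M).

Definition translate (x : M) : set M := [set x + h | h in [set h | h \in H]].

Definition rho : rel M := fun x y => `[< translate x `&` translate y !=set0 >].

Lemma rhoP x y :
  reflect (exists h k, [/\ h \in H, k \in H & x + h = y + k]) (rho x y).
Proof.
apply: (iffP (asboolP _)) => [[z [[h hH <-] [k kH e]]]|[h [k [hH kH e]]]].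
  by exists h, k.
by exists (x + h); split; [exists h | exists k].
Qed.

Lemma rho_refl : reflexive rho.
Proof. by move=> x; apply/rhoP; exists 0, 0; rewrite rpred0. Qed.

Lemma rho_sym : symmetric rho.
Proof. by move=> x y; rewrite /rho setIC. Qed.

Lemma rho_trans : transitive rho.
Proof.
move=> y x z /rhoP[h [k [hH kH e]]] /rhoP[h' [k' [hH' kH' e']]].
apply/rhoP; exists (h + h'), (k + k'); rewrite !rpredD //; split=> //.
by rewrite addrA e addrAC e' -addrA [k' + k]addrC.
Qed.

Canonical rho_equiv := EquivRel rho rho_refl rho_sym rho_trans.

Definition mquot := {eq_quot rho_equiv}.
HB.instance Definition _ := Choice.on mquot.
HB.instance Definition _ := EqQuotient.on mquot.

Definition mquot_zero : mquot := \pi_mquot 0.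
Definition mquot_add (X Y : mquot) : mquot := \pi_mquot (repr X + repr Y).

Lemma pi_mquot_add : {morph \pi_mquot : x y / x + y >-> mquot_add x y}.
Proof.
move=> x y; apply/eqmodP; rewrite /=.
have /eqmodP/rhoP[h [k [hH kH e]]] : x = repr (\pi_mquot x) %[mod mquot].
  by rewrite reprK.
have /eqmodP/rhoP[h' [k' [hH' kH' e']]] : y = repr (\pi_mquot y) %[mod mquot].
  by rewrite reprK.
by apply/rhoP; exists (h + h'), (k + k');
   rewrite !rpredD //; split=> //; rewrite addrACA e e' addrACA.
Qed.

Lemma mquot_addA : associative mquot_add.
Proof.
move=> X Y Z; rewrite -(reprK X) -(reprK Y) -(reprK Z).
move: (repr X) (repr Y) (repr Z) => x y z.
by rewrite -(pi_mquot_add y z) -(pi_mquot_add x y)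
   -(pi_mquot_add x (y + z)) -(pi_mquot_add (x + y) z) addrA.
Qed.

Lemma mquot_addC : commutative mquot_add.
Proof. by move=> X Y; rewrite /mquot_add addrC. Qed.

Lemma mquot_add0 : left_id mquot_zero mquot_add.
Proof. by move=> X; rewrite -(reprK X) -pi_mquot_add add0r. Qed.

HB.instance Definition _ :=
  GRing.isNmodule.Build mquot mquot_addA mquot_addC mquot_add0.

End Quotient.

(* M / H for submonoids M and H of T. The submonoid of M that is factored out
   is H `&` M, which is H itself when H is contained in M. *)
Definition subquot (T : nmodType) (M H : addrClosed T) : nmodType :=
  mquot (within M H).

Definition monoid_iso (A B : nmodType) : Prop :=
  exists f : {additive A -> B}, bijective f.

(* Main.v *)
Require Import Defs.
From mathcomp Require Import all_boot all_order all_algebra.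
From HB Require Import structures.
From mathcomp Require Import boolp.

Set Implicit Arguments.
Unset Strict Implicit.
Unset Printing Implicit Defensive.

Import GRing.Theory.
Local Open Scope ring_scope.
Local Open Scope quotient_scope.

(** The isomorphism is induced by the inclusion of Q in Q + N. It is onto
    because q + n is congruent to q modulo L + N. The content is injectivity
    ([order_ideal_cancel]): if q1 + l1 + n1 = q2 + l2 + n2, then refining
    (q1 + l1) + n1 = (q2 + l2) + n2 gives common parts
      q1 + l1 = e1 + e2,  n1 = e3 + e4,  q2 + l2 = e1 + e3,  n2 = e2 + e4,
    in which e2 and e3 lie below elements of Q and below elements of N, hence
    lie in both ideals, while (q1 + l1) + e3 = (q2 + l2) + e2.
    Thus q1 and q2 are already congruent modulo L + (Q `&` N). *)

Lemma mquot_piD (A : nmodType) (H : addrClosed A) (x y : A) :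
  \pi_(mquot H) (x + y) = \pi_(mquot H) x + \pi_(mquot H) y.
Proof. exact: pi_mquot_add. Qed.

(** An additive map that preserves and reflects the congruences, and whose image
    meets every class of the target, induces an isomorphism of quotients. *)
Lemma mquot_iso (A B : nmodType) (H : addrClosed A) (K : addrClosed B)
    (g : A -> B) :
  nmod_morphism g ->
  (forall x y, rho H x y = rho K (g x) (g y)) ->
  (forall y, exists x, rho K (g x) y) ->
  monoid_iso (mquot H) (mquot K).
Proof.
move=> [g0 gD] grho gsurj.
pose F (X : mquot H) : mquot K := \pi_(mquot K) (g (repr X)).
have Fpi x : F (\pi_(mquot H) x) = \pi_(mquot K) (g x).
  by apply/eqmodP; rewrite /= -grho; apply/eqmodP; rewrite reprK.
have F_additive : nmod_morphism F.
  split=> [|X Y]; first by rewrite -[0]/(\pi_(mquot H) 0) Fpi g0.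
  rewrite -(reprK X) -(reprK Y).
  by rewrite -mquot_piD !Fpi gD mquot_piD.
have F_inj : injective F.
  move=> X Y; rewrite -(reprK X) -(reprK Y) !Fpi => /eqmodP /= e.
  by apply/eqmodP; rewrite /= grho.
have F_surj Y : exists X, F X = Y.
  have [x gx] := gsurj (repr Y).
  by exists (\pi x); rewrite Fpi -[RHS]reprK; apply/eqmodP.
have [F' F'K] := choice F_surj.
pose Fm := GRing.isNmodMorphism.Build _ _ F F_additive.
pose Fadd : {additive mquot H -> mquot K} := HB.pack F Fm.
exists Fadd; exists F' => // X.
by apply: F_inj; rewrite F'K.
Qed.

(** Congruence modulo [within M H] of elements of M, read in the ambient
    monoid. *)
Lemma rho_withinP (T : nmodType) (M H : addrClosed T) (x y : submonoid M) :
  {subset H <= M} ->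
  reflect (exists h k, [/\ h \in H, k \in H & val x + h = val y + k])
          (rho (within M H) x y).
Proof.
move=> HM; apply: (iffP (rhoP _ _ _)) => [[h [k [hH kH e]]]|].
  by exists (val h), (val k); split=> //; rewrite -!raddfD e.
move=> [h [k [hH kH e]]].
exists (Sub h (HM _ hH)), (Sub k (HM _ kH)).
by split; rewrite ?unfold_in /within_pred ?SubK //; apply: val_inj; rewrite !raddfD.
Qed.

Lemma msumP (T : nmodType) (A B : addrClosed T) x :
  reflect (exists a b, [/\ a \in A, b \in B & x = a + b]) (x \in msum A B).
Proof. exact: asboolP. Qed.

Lemma mem_msum (T : nmodType) (A B : addrClosed T) a b :
  a \in A -> b \in B -> a + b \in msum A B.
Proof. by move=> aA bB; apply/msumP; exists a, b. Qed.

Lemma msum_sub (T : nmodType) (A B C : addrClosed T) :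
  {subset A <= C} -> {subset B <= C} -> {subset msum A B <= C}.
Proof. by move=> AC BC x /msumP[a [b [/AC aC /BC bC ->]]]; apply: rpredD. Qed.

Lemma sub_msuml (T : nmodType) (A B : addrClosed T) : {subset A <= msum A B}.
Proof. by move=> x xA; rewrite -[x]addr0; apply: mem_msum; rewrite ?rpred0. Qed.

Lemma sub_msumr (T : nmodType) (A B : addrClosed T) : {subset B <= msum A B}.
Proof. by move=> x xB; rewrite -[x]add0r; apply: mem_msum; rewrite ?rpred0. Qed.

(** An equality between elements of Q up to summands in N holds already up to
    summands in Q `&` N. *)
Lemma order_ideal_cancel (T : nmodType) (Q N : addrClosed T) a b m n :
  refinement T ->
  (forall x y, mle x y -> y \in Q -> x \in Q) ->
  (forall x y, mle x y -> y \in N -> x \in N) ->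
  a \in Q -> b \in Q -> m \in N -> n \in N -> a + m = b + n ->
  exists m' n', [/\ m' \in mcap Q N, n' \in mcap Q N & a + m' = b + n'].
Proof.
move=> refT Qle Nle aQ bQ mN nN /refT[e1 [e2 [e3 [e4 [ae me be ne]]]]].
subst a b m n; exists e3, e2; split; last by rewrite addrAC.
  apply/andP; split; last by apply: Nle mN; exists e4.
  by apply: Qle bQ; exists e1; rewrite addrC.
apply/andP; split; last by apply: Nle nN; exists e4.
by apply: Qle aQ; exists e1; rewrite addrC.
Qed.

Theorem theorem3p16 (G : zmodType) (T : nmodType) (act : gamma_action G T)
    (Q L N : addrClosed T) :
  refinement T ->
  gamma_order_ideal act Q ->
  gamma_order_ideal act L ->
  gamma_order_ideal act N ->
  {subset L <= Q} ->
  monoid_iso (subquot Q (msum L (mcap Q N))) (subquot (msum Q N) (msum L N)).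
Proof.
move=> refT [_ Qle] _ [_ Nle] LQ.
have capQ : {subset mcap Q N <= Q} by move=> x /andP[].
have capN : {subset mcap Q N <= N} by move=> x /andP[].
have subl : {subset msum L (mcap Q N) <= Q} by apply: msum_sub.
have subr : {subset msum L N <= msum Q N}.
  by apply: msum_sub => x xA; [apply/sub_msuml/LQ | apply: sub_msumr].
pose incl (x : submonoid Q) : submonoid (msum Q N) :=
  Sub (val x) (sub_msuml N (valP x)).
apply: (@mquot_iso _ _ _ _ incl) => [|x y|y].
- by split=> [|x y]; apply: val_inj; rewrite ?raddfD ?raddf0 /= ?raddfD ?raddf0.
- apply/(rho_withinP _ _ subl)/(rho_withinP _ _ subr).
    move=> [h [k [/msumP[l [m [lL mQN ->]]] /msumP[l' [m' [lL' mQN' ->]]] e]]].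
    by exists (l + m), (l' + m'); split=> //; apply: mem_msum => //; apply: capN.
  move=> [h [k [/msumP[l [m [lL mN ->]]] /msumP[l' [m' [lL' mN' ->]]]]]].
  rewrite /= !addrA => e.
  have lQ : val x + l \in Q by rewrite rpredD ?(valP x) ?LQ.
  have lQ' : val y + l' \in Q by rewrite rpredD ?(valP y) ?LQ.
  have [p [p' [pQN pQN' ep]]] := order_ideal_cancel refT Qle Nle lQ lQ' mN mN' e.
  by exists (l + p), (l' + p'); rewrite !mem_msum // !addrA.
- have /msumP[q [n [qQ nN yE]]] := valP y.
  exists (Sub q qQ); apply/(rho_withinP _ _ subr); exists n, 0.
  by rewrite (sub_msumr L nN) rpred0 addr0 yE.
Qed.
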